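(* Let $p$ be an odd prime, let $\mathcal{P}_p$ be the Paley (di)graph of order $p$ with adjacency matrix $A$, and set $\xi=1$ if $p\equiv1\bmod 4$ and $\xi=i=\sqrt{-1}$ if $p\equiv 3\bmod 4$. Then the number $(A^k)_{0,c}$ of walks of $k$ steps from $0$ to $c$ on $\mathcal{P}_p$ is given by one of the following. (i) If $c$ is a nonzero quadratic residue modulo $p$, then $$(A^k)_{0,c}=\begin{cases}\frac{1}{2^{k+1}p}\left(2(p-1)^k+(\sqrt p-1)^{k+1}+(-1)^{k+1}(\sqrt p+1)^{k+1}\right)&\text{if }p\equiv1\bmod4,\\[4pt] \frac{1}{2^{k+1}p}\left(2(p-1)^k+(p+1)(i\sqrt p-1)^{k-1}+(-1)^{k}(p+1)(i\sqrt p+1)^{k-1}\right)&\text{if }p\equiv3\bmod4.\end{cases}$$ (ii) If $c$ is a quadratic nonresidue modulo $p$, then $$(A^k)_{0,c}=\begin{cases}\frac{p-1}{2^{k+1}p}\left(2(p-1)^{k-1}+(\sqrt p-1)^{k-1}+(-1)^{k}(\sqrt p+1)^{k-1}\right)&\text{if }p\equiv1\bmod4,\\[4pt] \frac{1}{2^{k+1}p}\left(2(p-1)^k-(i\sqrt p+1)^{k+1}+(-1)^{k+1}(i\sqrt p+1)^{k+1}\right)&\text{if }p\equiv3\bmod4.\end{cases}$$ (iii) If $c=0$, then $$(A^k)_{0,0}=\frac{p-1}{2^{k+1}p}\left(2(p-1)^{k-1}+(\xi\sqrt p-1)^k+(-1)^k(\xi\sqrt p+1)^k\right).$$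
   Context: The Paley (di)graph $\mathcal{P}_p$ has node set $\mathbb{Z}_p=\{0,1,\dots,p-1\}$, with an arrow from $a$ to $b$ if and only if $b-a$ is a nonzero square modulo $p$; when $p\equiv1\bmod4$ this relation is symmetric and $\mathcal{P}_p$ is an undirected graph, and when $p\equiv3\bmod4$ it is a directed graph. $A$ is the $0/1$ matrix with $(a,b)$-entry $1$ exactly when there is an arrow from $a$ to $b$, so $(A^k)_{a,b}$ counts walks of $k$ steps from $a$ to $b$.
   Formalization: Three misprinted terms are corrected: in (i), p≡3 mod 4, (-1)^k becomes (-1)^{k+1}; in (ii), p≡1 mod 4, +(√p-1)^{k-1} becomes -(√p-1)^{k-1}; in (ii), p≡3 mod 4, -(i√p+1)^{k+1} becomes +(i√p-1)^{k+1}. *)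

(* Defs.v *)
From HB Require Import structures.
From mathcomp Require Import all_boot all_order all_algebra.

Set Implicit Arguments.
Unset Strict Implicit.
Unset Printing Implicit Defensive.

Import GRing.Theory.
Local Open Scope ring_scope.

Definition is_square (p : nat) (x : 'F_p) : bool := [exists y : 'F_p, x == y ^+ 2].

Definition quadratic_residue (p : nat) (x : 'F_p) : bool :=
  (x != 0) && is_square x.

Definition quadratic_nonresidue (p : nat) (x : 'F_p) : bool :=
  (x != 0) && ~~ is_square x.

Definition paley_arrow (p : nat) : rel 'F_p :=
  fun a b => quadratic_residue (b - a).

(* The ordinal type 'F_p, equal to {0, ..., p-1} when p is prime, indexes the
   rows and columns; (Zp_trunc (pdiv p)).+2 is its cardinal. *)
Definition paley_adj (p : nat) : 'M[nat]_((Zp_trunc (pdiv p)).+2) :=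
  \matrix_(a, b) nat_of_bool (@paley_arrow p a b).

Definition paley_walks (p k : nat) (a b : 'F_p) : {set k.-tuple 'F_p} :=
  [set w : k.-tuple 'F_p | path (@paley_arrow p) a w && (last a w == b)].

Lemma paley_adj_walks (p k : nat) (a b : 'F_p) :
  (paley_adj p ^+ k) a b = #|paley_walks k a b|.
Proof.
elim: k a => [|k IHk] a.
  rewrite expr0 mxE; case: eqVneq => [->|ne].
    rewrite (eq_card (B := predT)) ?card_tuple ?expn0 // => w.
    by rewrite !inE tuple0 /= eqxx.
  by rewrite eq_card0 // => w; rewrite !inE tuple0 /= (negbTE ne).
rewrite exprS mxE.
transitivity (\sum_(x : 'F_p) \sum_(w in paley_walks k x b)
   nat_of_bool (paley_arrow a x))%N.
  by apply: eq_bigr => x _; rewrite IHk sum_nat_const mxE mulnC.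
rewrite (eq_bigr _ (fun x _ => big_mkcond _ _)) /= pair_bigA /= -sum1_card.
rewrite [RHS]big_mkcond /=.
rewrite (reindex (fun w : k.+1.-tuple 'F_p => (thead w, [tuple of behead w]))) /=.
  apply: eq_bigr => w _; rewrite !inE; case/tupleP: w => x w /=.
  by rewrite theadE; case: (paley_arrow a x) => //=; case: ifP.
exists (fun u : 'F_p * k.-tuple 'F_p => [tuple of u.1 :: u.2]) => [w _|[x w] _].
  by apply: val_inj; rewrite /= {3}(tuple_eta w).
by congr (_, _); apply: val_inj.
Qed.

(* Main.v *)
(* Let [chi] be the quadratic character of F_p, [S] the matrix with entries
   [chi (b - a)], and [J] the all-ones matrix, so that [A = (J - 1 + S) / 2].
   The identities [J^2 = p J], [S J = J S = 0] and, by evaluating the Jacobi sum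
   of [chi] with itself, [S^2 = chi (-1) (p - J)] show that for
   [T^2 = chi (-1) p] the matrix [A] has eigenvalues [(p - 1) / 2],
   [(T - 1) / 2] and [(- T - 1) / 2], with projectors [J / p] and
   [(p - J + p S / T) / 2 p], [(p - J - p S / T) / 2 p].  The entries of [A^k]
   follow, with [T = sqrt p] or [T = i sqrt p] according to [p] modulo 4. *)
Require Import Defs.
From mathcomp Require Import all_boot all_order all_algebra.
From mathcomp Require Import finfield cyclic ring zify.
Import GRing.Theory Num.Theory.
Local Open Scope ring_scope.

(** * Generators of the multiplicative group of a finite field *)

Lemma finField_primitive_root (F : finFieldType) :
  exists g : F, #|F|.-1.-primitive_root g.
Proof.
have q_gt1 : (1 < #|F|)%N by exact: finNzRing_gt1.
(* The nonzero elements are [#|F|.-1] distinct roots of unity of that order; so many force a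
   primitive one among them. *)
have /hasP[g _ gP] : has #|F|.-1.-primitive_root (enum (predC1 (0 : F))).
  apply: has_prim_root; first by rewrite -ltnS prednK // ltnW.
  - apply/allP=> x; rewrite mem_enum inE unity_rootE => x0.
    by apply/eqP/(mulfI x0); rewrite mulr1 -exprS prednK ?expf_card // ltnW.
  - exact: enum_uniq.
  - by rewrite -cardE cardC1.
by exists g.
Qed.

Lemma finField_log (F : finFieldType) (g x : F) :
  #|F|.-1.-primitive_root g -> x != 0 -> exists i, x = g ^+ i.
Proof.
move=> gP x0; have x1 : x ^+ #|F|.-1 = 1.
  apply: (mulfI x0); rewrite mulr1 -exprS prednK ?expf_card //.
  by rewrite ltnW // finNzRing_gt1.
by have [j ->] := prim_rootP gP x1; exists j.
Qed.

(** * Quadratic character and its Jacobi sum *)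

Definition quad_char (R : pzRingType) {F : finFieldType} (x : F) : R :=
  if x == 0 then 0 else if [exists y : F, x == y ^+ 2] then 1 else -1.

Section QuadraticCharacter.

Variables (R : numDomainType) (F : finFieldType).
Hypothesis odd_F : odd #|F|.

Notation chi := (@quad_char R F).

Let q_gt1 : (1 < #|F|)%N. Proof. exact: finNzRing_gt1. Qed.

Lemma quad_char0 : chi 0 = 0.
Proof. by rewrite /quad_char eqxx. Qed.

(** Since [#|F|.-1] is even, a power of [g] determines the parity of its exponent, so the squares
    are exactly the even powers. Multiplicativity and the value at -1 are read off from this. *)
Lemma quad_char_primitive_root (g : F) (i : nat) :
  #|F|.-1.-primitive_root g -> chi (g ^+ i) = (-1) ^+ i.
Proof.
move=> gP; have g0 : g != 0.
  apply/eqP=> g0; move/prim_expr_order: gP; rewrite g0 expr0n.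
  by case: #|F| q_gt1 => [|[]] // n _ /eqP; rewrite eq_sym oner_eq0.
rewrite /quad_char expf_eq0 (negPf g0) andbF -signr_odd.
have -> : [exists y, g ^+ i == y ^+ 2] = ~~ odd i; last by case: (odd i).
apply/existsP/idP => [[y /eqP giy]|i_even]; last first.
  by exists (g ^+ i./2); rewrite -exprM muln2 -[in g ^+ i](odd_double_half i) (negPf i_even).
have y0 : y != 0.
  by apply/eqP=> y0; move/eqP: giy; rewrite y0 expr0n expf_eq0 (negPf g0) andbF.
have y1 : y ^+ #|F|.-1 = 1.
  by apply: (mulfI y0); rewrite mulr1 -exprS prednK ?expf_card // ltnW.
have [j yj] := prim_rootP gP y1.
have := eq_prim_root_expr gP i (j * 2); rewrite exprM -yj giy eqxx => /esym/eqP ij.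
have dv : (2 %| #|F|.-1)%N by rewrite dvdn2 -oddS prednK // ltnW.
rewrite -dvdn2 /dvdn -(modn_dvdm _ dv) ij modn_dvdm //.
by rewrite -/(dvdn _ _) dvdn_mull.
Qed.

Lemma quad_charM : {morph chi : x y / x * y}.
Proof.
move=> x y; have [->|x0] := eqVneq x 0; first by rewrite mul0r quad_char0 mul0r.
have [->|y0] := eqVneq y 0; first by rewrite mulr0 quad_char0 mulr0.
have [g gP] := finField_primitive_root F.
have [[i ->] [j ->]] := (finField_log _ _ _ gP x0, finField_log _ _ _ gP y0).
by rewrite -exprD !quad_char_primitive_root // exprD.
Qed.

Lemma quad_char_sqr (x : F) : chi (x ^+ 2) = (x != 0)%:R.
Proof.
rewrite /quad_char expf_eq0 /=; case: eqP => //= _.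
by case: existsP => // -[]; exists x.
Qed.

Lemma quad_charN1 : chi (-1) = (-1) ^+ (#|F|.-1./2).
Proof.
have [g gP] := finField_primitive_root F.
have n_even : (#|F|.-1./2.*2 = #|F|.-1)%N.
  rewrite -[RHS]odd_double_half; have := odd_F.
  by rewrite -{1}(prednK (ltnW q_gt1)) oddS => /negPf->.
suff -> : (-1 : F) = g ^+ (#|F|.-1./2) by exact: quad_char_primitive_root.
have /eqP : (g ^+ (#|F|.-1./2)) ^+ 2 = 1.
  by rewrite -exprM muln2 n_even prim_expr_order.
(* The half power is a square root of 1; it is not 1 because its exponent is positive and below the
   order of [g]. *)
rewrite sqrf_eq1 -(prim_order_dvd gP) => /orP[|/eqP->//].
have := prim_order_gt0 gP; rewrite -n_even doubleK double_gt0 => m_gt0.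
move/(dvdn_leq m_gt0).
by rewrite leqNgt -addnn -[ltnLHS]addn0 ltn_add2l m_gt0.
Qed.

(** Multiplication by a generator permutes the field and negates [chi], so the sum equals its
    opposite. *)
Lemma sum_quad_char : \sum_x chi x = 0.
Proof.
have [g gP] := finField_primitive_root F.
have chig : chi g = -1 by rewrite -[g]expr1 quad_char_primitive_root.
have g0 : g != 0.
  apply/eqP=> g0; move/eqP: chig; rewrite g0 quad_char0.
  by rewrite eq_sym oppr_eq0 oner_eq0.
have : \sum_x chi x = - \sum_x chi x.
  rewrite {1}(reindex_inj (mulfI g0)) /= -mulN1r -chig mulr_sumr.
  by apply: eq_bigr => x _; rewrite quad_charM.
by move/eqP; rewrite -subr_eq0 opprK -mulr2n mulrn_eq0 => /eqP.
Qed.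

Lemma quad_char_convolution (c : F) :
  \sum_x chi x * chi (c - x) = chi (-1) * (#|F|%:R * (c == 0)%:R - 1).
Proof.
have [->|c0] := eqVneq c 0.
  (* For [c = 0] each nonzero [x] contributes [chi (- x ^+ 2) = chi (-1)]. *)
  rewrite mulr1 (bigD1 0) //= quad_char0 mul0r add0r.
  rewrite (eq_bigr (fun=> chi (-1))); last first.
    move=> x x0; rewrite sub0r -[- x]mulN1r quad_charM mulrCA -quad_charM -expr2.
    by rewrite quad_char_sqr x0 mulr1.
  rewrite sumr_const mulrBr mulr1 mulr_natr -{1}(prednK (ltnW q_gt1)) mulrS.
  by rewrite addrAC subrr add0r cardC1.
rewrite mulr0 sub0r mulrN1.
(* For [x != 0], [chi x * chi (c - x) = chi (c / x - 1)], and [c / x] runs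
   over all nonzero elements. *)
transitivity (\sum_(x | x != 0) chi (x - 1)).
  rewrite (bigD1 0) //= quad_char0 mul0r add0r.
  rewrite [RHS](reindex_onto (fun x => c / x) (fun x => c / x)) /=; last first.
    by move=> x x0; rewrite invf_div mulrC divfK.
  apply: eq_big => [x|x x0].
    have [->|x0] := eqVneq x 0; first by rewrite invr0 mulr0 eqxx.
    by rewrite mulf_neq0 ?invr_eq0 // invf_div mulrC divfK ?eqxx.
  rewrite -quad_charM -[RHS]mul1r.
  have <- : chi (x ^+ 2) = 1 by rewrite quad_char_sqr x0.
  by rewrite -quad_charM expr2 -mulrA [x * (_ - 1)]mulrBr mulr1 [x * (c / x)]mulrC divfK.
(* The full sum vanishes, so what remains is minus the omitted term [chi (0 - 1)]. *)
have := sum_quad_char; rewrite (reindex_inj (addIr (-1))) (bigD1 0) //= sub0r.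
by move/eqP; rewrite addrC addr_eq0 => /eqP.
Qed.

End QuadraticCharacter.

(** * Spectral decomposition of the adjacency matrix *)

Section PaleyMatrix.

Variables (R : numFieldType) (p : nat) (p_prime : prime p) (p_odd : odd p).

Local Notation chi := (@quad_char R 'F_p).
Local Notation n := ((Zp_trunc (pdiv p)).+2).

Let odd_Fp : odd #|'F_p|. Proof. by rewrite card_Fp. Qed.

Let J : 'M[R]_n := const_mx 1.
Let S : 'M[R]_n := \matrix_(a, b) chi ((b : 'F_p) - a).

(* [p^-1 / 2 *: B T] is the spectral projector for [(T - 1) / 2]. *)
Let B (T : R) : 'M[R]_n := p%:R *: 1 - J + (p%:R / T) *: S.

(** Translating the summation index by [a] turns entry [(a, b)] into the convolution at [b - a]. *)
Lemma quad_char_mx_sqr : S * S = chi (-1) *: (p%:R *: 1 - J).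
Proof.
apply/matrixP=> a b; rewrite !mxE.
rewrite (reindex_inj (addIr (a : 'F_p))) /=.
rewrite -[in p%:R](card_Fp p_prime).
rewrite [a == b]eq_sym -[b == a](subr_eq0 (b : 'F_p) a) -quad_char_convolution //.
by apply: eq_bigr => x _; rewrite !mxE addrK opprD addrA addrAC.
Qed.

Lemma quad_char_mx_ones : S * J = 0.
Proof.
apply/matrixP=> a b; rewrite !mxE (reindex_inj (addIr (a : 'F_p))) /=.
rewrite -[RHS](sum_quad_char R _ odd_Fp).
by apply: eq_bigr => x _; rewrite !mxE mulr1 addrK.
Qed.

Lemma ones_quad_char_mx : J * S = 0.
Proof.
apply/matrixP=> a b; rewrite !mxE (reindex_inj (subrI (b : 'F_p))) /=.
rewrite -[RHS](sum_quad_char R _ odd_Fp).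
by apply: eq_bigr => x _; rewrite !mxE mul1r subKr.
Qed.

Lemma ones_mx_sqr : J * J = p%:R *: J.
Proof.
apply/matrixP=> a b; rewrite !mxE (eq_bigr (fun=> 1)); last first.
  by move=> x _; rewrite !mxE mulr1.
by rewrite sumr_const mulr1 (card_Fp p_prime).
Qed.

Lemma paley_adj_natr (a b : 'F_p) :
  (paley_adj p a b)%:R = (2^-1 *: (J - 1 + S)) a b.
Proof.
rewrite !mxE /paley_arrow /quadratic_residue /quad_char /is_square.
rewrite subr_eq0 eq_sym [a == b :> 'F_p]eq_sym.
case: (b == a) => /=; first by rewrite subrr add0r mulr0.
by case: ifP => _ /=; field.
Qed.

(** Right multiplication by [J] kills [B T], and by [S] scales it by [T], because
    [chi (-1) * p / T = T]. *)
Lemma paley_projector (T : R) : T != 0 -> T ^+ 2 = chi (-1) * p%:R ->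
  B T * (2^-1 *: (J - 1 + S)) = ((T - 1) / 2) *: B T.
Proof.
move=> T0 T2.
have BJ : B T * J = 0.
  rewrite mulrDl mulrBl -!scalerAl mul1r ones_mx_sqr quad_char_mx_ones.
  by rewrite subrr scaler0 addr0.
have BS : B T * S = T *: B T.
  rewrite mulrDl mulrBl -!scalerAl mul1r ones_quad_char_mx quad_char_mx_sqr.
  rewrite subr0 scalerA addrC [in RHS]scalerDr scalerA.
  have -> : p%:R / T * chi (-1) = T.
    by rewrite mulrAC [p%:R * _]mulrC -T2 expr2 mulfK.
  by rewrite [T * _]mulrC divfK.
rewrite -scalerAr mulrDr mulrBr BJ BS mulr1 sub0r addrC -scaleN1r -scalerDl.
by rewrite scalerA mulrC.
Qed.

Lemma paley_adj_exp (T : R) (k : nat) (a b : 'F_p) :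
  T != 0 -> T ^+ 2 = chi (-1) * p%:R ->
  ((paley_adj p ^+ k) a b)%:R =
  p%:R^-1 * (((p%:R - 1) / 2) ^+ k
   + ((T - 1) / 2) ^+ k / 2 * (p%:R * (a == b)%:R - 1 + p%:R / T * chi (b - a))
   + ((- T - 1) / 2) ^+ k / 2
     * (p%:R * (a == b)%:R - 1 - p%:R / T * chi (b - a))).
Proof.
move=> T0 T2; have p0 : p%:R != 0 :> R by rewrite pnatr_eq0 -lt0n prime_gt0.
set M := 2^-1 *: (J - 1 + S).
have MX : forall x y, ((paley_adj p ^+ k) x y)%:R = (M ^+ k) x y.
  elim: k => [|k IHk] x y; first by rewrite !expr0 !mxE; case: (x == y).
  rewrite !exprSr !mxE natr_sum; apply: eq_bigr => z _.
  by rewrite natrM IHk paley_adj_natr.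
have JM : J * M = ((p%:R - 1) / 2) *: J.
  rewrite -scalerAr mulrDr mulrBr ones_mx_sqr ones_quad_char_mx mulr1 addr0.
  by rewrite -{2}[J]scale1r -scalerBl scalerA mulrC.
have NT0 : - T != 0 by rewrite oppr_eq0.
have NT2 : (- T) ^+ 2 = chi (-1) * p%:R by rewrite sqrrN.
rewrite MX; suff -> : M ^+ k = p%:R^-1 *: (((p%:R - 1) / 2) ^+ k *: J
    + (((T - 1) / 2) ^+ k / 2) *: B T + (((- T - 1) / 2) ^+ k / 2) *: B (- T)).
  by rewrite !mxE invrN mulrN mulNr mulr1.
(* At [k = 0] this is the resolution of the identity: [B T + B (- T)] is twice [p - J]. Each further
   factor [M] multiplies every summand by its eigenvalue. *)
elim: k {MX} => [|k IHk].
  apply/matrixP=> x y; rewrite !expr0 !mxE; field.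
  by rewrite p0 T0.
rewrite exprSr IHk -scalerAl 2!mulrDl -!scalerAl JM !paley_projector // !scalerA !exprSr.
by rewrite ![_ ^+ k / 2 * _]mulrAC.
Qed.


Lemma Fp_quad_charN1 : chi (-1) = (-1) ^+ (p %% 4 == 3)%N.
Proof.
rewrite quad_charN1 // (card_Fp p_prime) -signr_odd; congr (_ ^+ _).
by have := p_odd; lia.
Qed.

End PaleyMatrix.

(** Three formulas deviate from the English ones, which already fail at [k = 1]: the sign of the
    last term in (i) for [p] = 3 mod 4, the sign of the middle term in (ii) for [p] = 1 mod 4, and
    the middle term [('i * s - 1) ^+ k.+1] in (ii) for [p] = 3 mod 4. Powers [k - 1] have integer
    exponents, so [k = 0] gives inverses. *)
Theorem theorem3p7 (C : numClosedFieldType) (p : nat) (p_prime : prime p)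
    (p_odd : odd p) (k : nat) (c : 'F_p) :
  let A : 'M[nat]_((Zp_trunc (pdiv p)).+2) := paley_adj p in
  let s : C := sqrtC p%:R in
  let xi : C := if (p %% 4 == 1)%N then 1 else 'i in
  [/\ quadratic_residue c ->
        ((p %% 4 = 1)%N ->
          ((A ^+ k) 0 c)%:R =
            1 / (2 ^+ k.+1 * p%:R) *
            (2 * (p%:R - 1) ^+ k + (s - 1) ^+ k.+1
             + (-1) ^+ k.+1 * (s + 1) ^+ k.+1)) /\
        ((p %% 4 = 3)%N ->
          ((A ^+ k) 0 c)%:R =
            1 / (2 ^+ k.+1 * p%:R) *
            (2 * (p%:R - 1) ^+ k
             + (p%:R + 1) * ('i * s - 1) ^ (k%:Z - 1)
             + (-1) ^+ k.+1 * (p%:R + 1) * ('i * s + 1) ^ (k%:Z - 1))),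
      quadratic_nonresidue c ->
        ((p %% 4 = 1)%N ->
          ((A ^+ k) 0 c)%:R =
            (p%:R - 1) / (2 ^+ k.+1 * p%:R) *
            (2 * (p%:R - 1) ^ (k%:Z - 1) - (s - 1) ^ (k%:Z - 1)
             + (-1) ^+ k * (s + 1) ^ (k%:Z - 1))) /\
        ((p %% 4 = 3)%N ->
          ((A ^+ k) 0 c)%:R =
            1 / (2 ^+ k.+1 * p%:R) *
            (2 * (p%:R - 1) ^+ k + ('i * s - 1) ^+ k.+1
             + (-1) ^+ k.+1 * ('i * s + 1) ^+ k.+1))
    & c = 0 ->
        ((A ^+ k) 0 0)%:R =
          (p%:R - 1) / (2 ^+ k.+1 * p%:R) *
          (2 * (p%:R - 1) ^ (k%:Z - 1) + (xi * s - 1) ^+ k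
           + (-1) ^+ k * (xi * s + 1) ^+ k)].
Proof.
move=> A s xi.
have p_gt1 := prime_gt1 p_prime.
have p0 : p%:R != 0 :> C by rewrite pnatr_eq0 -lt0n ltnW.
have p1 : p%:R - 1 != 0 :> C by rewrite subr_eq0 pnatr_eq1 gtn_eqF.
have pN1 : p%:R + 1 != 0 :> C by rewrite -mulrSr pnatr_eq0.
have s2 : s ^+ 2 = p%:R by rewrite sqrtCK.
have s0 : s != 0 by rewrite sqrtC_eq0.
have is2 : ('i * s) ^+ 2 = - p%:R by rewrite exprMn sqrCi s2 mulN1r.
have is0 : 'i * s != 0 by rewrite mulf_neq0 // neq0Ci.
(* Factoring [p - 1] over [s] and [p + 1] over ['i * s] shows that the bases are nonzero, so that a
   power [k - 1] is a quotient even at [k = 0]. *)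
have sp1 : s + 1 != 0.
  by apply: contraNneq p1 => s1; rewrite -s2 subr_sqr_1 s1 mulr0.
have sm1 : s - 1 != 0.
  by apply: contraNneq p1 => s1; rewrite -s2 subr_sqr_1 s1 mul0r.
have isq : p%:R + 1 = - (('i * s - 1) * ('i * s + 1)).
  by rewrite -subr_sqr_1 is2 opprB opprK addrC.
have isp1 : 'i * s + 1 != 0.
  by apply: contraNneq pN1 => s1; rewrite isq s1 mulr0 oppr0.
have ism1 : 'i * s - 1 != 0.
  by apply: contraNneq pN1 => s1; rewrite isq s1 mul0r oppr0.
have expB1 (x : C) : x != 0 -> x ^ (k%:Z - 1) = x ^+ k / x.
  by move=> x0; rewrite expfzDr // exprN1.
have chiR (x : 'F_p) : quadratic_residue x -> quad_char C x = 1.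
  by rewrite /quadratic_residue /is_square /quad_char => /andP[/negPf-> ->].
have chiN (x : 'F_p) : quadratic_nonresidue x -> quad_char C x = -1.
  by rewrite /quadratic_nonresidue /is_square /quad_char => /andP[/negPf-> /negPf->].
have T1 : (p %% 4 = 1)%N -> s ^+ 2 = quad_char C (-1 : 'F_p) * p%:R.
  by move=> p4; rewrite Fp_quad_charN1 // p4 mul1r.
have T3 : (p %% 4 = 3)%N -> ('i * s) ^+ 2 = quad_char C (-1 : 'F_p) * p%:R.
  by move=> p4; rewrite Fp_quad_charN1 // p4 mulN1r.
have NB (T : C) : ((- T - 1) / 2) ^+ k = (-1) ^+ k * (T + 1) ^+ k / 2 ^+ k.
  by rewrite expr_div_n -opprD [in LHS]exprNn.
split=> [cR|cN|c0].
- have cn0 : (0 == c) = false by rewrite eq_sym; case/andP: cR => /negPf.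
  split=> p4.
    rewrite (paley_adj_exp _ _ p_prime p_odd _ k 0 c s0 (T1 p4)) cn0 mulr0n subr0 chiR // NB.
    (* With [p] written as [s ^+ 2], a rational identity in [s] and [k]-th powers remains. *)
    rewrite !expr_div_n !exprS -s2.
    by field; rewrite s0 expf_neq0 ?pnatr_eq0.
  rewrite (paley_adj_exp _ _ p_prime p_odd _ k 0 c is0 (T3 p4)) cn0 mulr0n subr0 chiR // NB.
  rewrite !expr_div_n !expB1 // !exprS -[p%:R]opprK -is2.
  by field; rewrite isp1 ism1 s0 neq0Ci expf_neq0 ?pnatr_eq0.
- have cn0 : (0 == c) = false by rewrite eq_sym; case/andP: cN => /negPf.
  split=> p4.
    rewrite (paley_adj_exp _ _ p_prime p_odd _ k 0 c s0 (T1 p4)) cn0 mulr0n subr0 chiN // NB.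
    rewrite !expr_div_n !expB1 // !exprS -s2.
    by field; rewrite s0 sp1 sm1 s2 p1 expf_neq0 ?pnatr_eq0.
  rewrite (paley_adj_exp _ _ p_prime p_odd _ k 0 c is0 (T3 p4)) cn0 mulr0n subr0 chiN // NB.
  rewrite !expr_div_n !exprS -[p%:R]opprK -is2.
  by field; rewrite s0 neq0Ci expf_neq0 ?pnatr_eq0.
(* The choice [T = xi * s] treats both classes modulo 4 at once. *)
- have [T0 T2] : xi * s != 0 /\ (xi * s) ^+ 2 = quad_char C (-1 : 'F_p) * p%:R.
    rewrite /xi; case: (p %% 4 =P 1)%N => p4; first by rewrite mul1r; split=> //; exact: T1.
    by split=> //; apply: T3; lia.
  rewrite (paley_adj_exp _ _ p_prime p_odd _ k 0 0 T0 T2) eqxx mulr1n subr0 quad_char0 NB.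
  rewrite !expr_div_n !expB1 // !exprS.
  have xi0 : xi != 0 by move: T0; rewrite mulf_eq0 (negPf s0) orbF.
  by field; rewrite p0 p1 xi0 s0 expf_neq0 ?pnatr_eq0.
Qed.
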